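(* Let $n,m\ge 1$ be integers, let $W\in\mathbb{R}^{2m\times n}$ and $K\in\mathbb{R}^{n\times n}$, put $\Omega=K-K^T$, and define the OS-net weights by $W_e^T=W$ and $W_d^T=\Omega W^T$. Let $b_e\in\mathbb{R}^{2m}$ and let $\sigma:\mathbb{R}\to\mathbb{R}$ be a continuously differentiable activation function. Let $T>0$ and let $\phi(t,x_0)$ be a $T$-periodic solution of the OS-net system $$\dot x = W_d^T\,\sigma(W_e^T x+b_e),\qquad x(0)=x_0\in\mathbb{R}^n,$$ where $\sigma$ is applied componentwise. Let $J=W_e^TW_d^T=W\Omega W^T\in\mathbb{R}^{2m\times 2m}$ and let $J_a$ be the matrix obtained from $J$ by replacing each entry by its absolute value. Suppose that $\sigma$ is strictly increasing with a uniformly bounded derivative, and let $L=\sup_{s\in\mathbb{R}}\sigma'(s)$. Then OS-net is stable if $$\|J_a\|_2<\frac{2}{LT}.$$ Here ''OS-net is stable'' means that $\lambda=1$ belongs to the central zone of stability of the system $\dot z=\lambda J H(t)z$, where $H(t)=\mathrm{diag}\big(\sigma'(W_e^T\phi(t,x_0)+b_e)\big)$.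
   Context: $\|\cdot\|_2$ denotes the spectral (operator 2-) norm of a matrix. For a vector $v$, $\mathrm{diag}(v)$ is the diagonal matrix with diagonal $v$, and $\sigma'$ is applied componentwise. Here $n$ is the input size (the dimension of $x$) and $2m$ is the size of the hidden layer. The matrix $J=W\Omega W^T$ is skew-symmetric because $\Omega=K-K^T$ is. The first variational equation of the OS-net system along $\phi$ is $\dot y = W_d^T H(t) W_e^T y$. With $z=W_e^T y$ it becomes $\dot z = J H(t) z$, where $H$ is $T$-periodic. Stability of OS-net refers to this linear periodic system, regarded as the member $\lambda=1$ of the family $\dot z=\lambda J H(t) z$, $\lambda\in\mathbb{R}$. Stability zones: a real $\lambda_0$ is a point of stability of $\dot z=\lambda J H(t)z$ if for $\lambda=\lambda_0$ all solutions are bounded on the entire $t$-axis. It is a point of strong stability if, in addition, for $\lambda=\lambda_0$ all solutions of $\dot z=\lambda J H_1(t) z$ are bounded on the entire $t$-axis for every $T$-periodic symmetric matrix-valued function $H_1$ sufficiently close to $H$. The set of points of strong stability is open and decomposes into disjoint open intervals called zones of stability. A zone of stability containing $\lambda=0$ is called a central zone of stability.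
   Formalization: Added hypothesis: no diagonal entry of H(t) vanishes identically (automatic if σ' > 0 everywhere). Without it the claim fails, e.g. W = I, b_e = 0, σ(s) = s − sin s, φ = 0, where H = 0 and λ = 1 is not strongly stable. *)

(* Defs.v *)
From HB Require Import structures.
From mathcomp Require Export all_boot all_order all_algebra.
From mathcomp Require Export all_classical all_reals all_analysis.

Set Implicit Arguments.
Unset Strict Implicit.
Unset Printing Implicit Defensive.

Export Order.TTheory GRing.Theory Num.Theory.
Export numFieldNormedType.Exports.

#[export] Set Implicit Arguments.
#[export] Unset Strict Implicit.
#[export] Unset Printing Implicit Defensive.

Local Open Scope classical_set_scope.
Local Open Scope ring_scope.

Definition norm2 (R : realType) (n : nat) (v : 'cV[R]_n) : R :=
  Num.sqrt (\sum_i v i 0 ^+ 2).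

Definition spectral_norm (R : realType) (m n : nat) (A : 'M[R]_(m, n)) : R :=
  sup [set norm2 (A *m v) | v in [set v : 'cV[R]_n | norm2 v <= 1]].

Definition abs_mx (R : realType) (m n : nat) (A : 'M[R]_(m, n)) :
  'M[R]_(m, n) := map_mx (fun a : R => `|a|) A.

(* Topology and norm on matrices are the library's entrywise ones
   (`|A| = max_ij `|A i j|). *)

Definition solves (R : realType) (k : nat)
    (F : R -> 'cV[R]_k -> 'cV[R]_k) (z : R -> 'cV[R]_k) : Prop :=
  forall t : R, is_derive t 1 z (F t (z t)).

Definition periodic (R : realType) (U : Type) (T : R) (f : R -> U) : Prop :=
  forall t : R, f (t + T) = f t.

Section Zones.
Variables (R : realType) (k : nat).
Implicit Types (T l : R) (J : 'M[R]_k) (H : R -> 'M[R]_k) (Z : set R).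

Definition stable_point J H l : Prop :=
  forall z : R -> 'cV[R]_k,
    solves (fun t y => l *: (J *m H t *m y)) z ->
    exists M : R, forall t : R, `|z t| <= M.

(* Perturbations range over the continuous T-periodic symmetric functions, and
   closeness is uniform in t. *)
Definition strongly_stable_point T J H l : Prop :=
  stable_point J H l /\
  exists2 eps : R, 0 < eps &
    forall H1 : R -> 'M[R]_k,
      continuous H1 -> periodic T H1 -> (forall t, (H1 t)^T = H1 t) ->
      (forall t, `|H1 t - H t| < eps) ->
      stable_point J H1 l.

(* Openness is required so that a degenerate component such as [set 0] does not
   qualify; an open connected component in R is a maximal open interval. *)
Definition stability_zone T J H Z : Prop :=
  open Z /\
  exists2 l : R, strongly_stable_point T J H l &
    Z = connected_component [set l' | strongly_stable_point T J H l'] l.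

Definition central_stability_zone T J H Z : Prop :=
  stability_zone T J H Z /\ Z 0.

End Zones.

Section OSnet.
Variables (R : realType) (n m : nat).
Implicit Types (W : 'M[R]_(2 * m, n)) (K : 'M[R]_n) (b : 'cV[R]_(2 * m)).
Implicit Types (sigma : R -> R) (phi : R -> 'cV[R]_n).

Definition OmegaK K : 'M[R]_n := K - K^T.

(* We^T and Wd^T *)
Definition WeT W : 'M[R]_(2 * m, n) := W.
Definition WdT W K : 'M[R]_(n, 2 * m) := OmegaK K *m W^T.

Definition osnet_field W K b sigma (x : 'cV[R]_n) : 'cV[R]_n :=
  WdT W K *m map_mx sigma (WeT W *m x + b).

Definition osnet_J W K : 'M[R]_(2 * m) := WeT W *m WdT W K.

Definition osnet_H W b sigma phi (t : R) : 'M[R]_(2 * m) :=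
  diag_mx (map_mx (derive1 sigma) (WeT W *m phi t + b))^T.

Definition osnet_stable W K b sigma phi (T : R) : Prop :=
  exists2 Z : set R,
    central_stability_zone T (osnet_J W K) (osnet_H W b sigma phi) Z & Z 1.

End OSnet.

(* Main.v *)
Require Import Defs.
From mathcomp Require Import ring lra.

(** Let A = l J with |l| <= 1, a skew matrix, and let z solve z' = A H1(t) z for a
    symmetric T-periodic H1. Put s' = H1 z, so that
    z(t + T) - z(t) = A (s(t + T) - s(t)). Then the number

      q(t) = <z(t), s(t + T) - s(t)>

    has derivative zero, by skewness of A and symmetry of H1
    ([period_form_const]). It is the quadratic form of the Cayley transform of the
    monodromy matrix, but it makes sense for a single solution, so neither a
    fundamental matrix nor an existence theorem for linear equations is involved,
    and A may be singular. Solutions are bounded as soon as q(a) >= c |z(a)|^2 with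
    c independent of a.

    This coercivity is where the norm condition enters. For H1 = H = diag(h) with
    0 <= h <= L, substitute z(a) = z - A s in q(a), with s vanishing at a:

      2 q(a) = 2 (integral of <z, H z>) - 2 (integral of <A s, s'>).

    With p_i the integral of h_i |z_i| one has |s_i| <= p_i, and the last term is
    at most <p, J_a p> <= ||J_a|| |p|^2 <= ||J_a|| L T (integral of <z, H z>), the
    last step by Cauchy-Schwarz. As ||J_a|| L T < 2, q(a) dominates the integral of
    <z, H z> over a period. That integral in turn dominates the square of the
    maximum of |z| over the period: if it is small, then so is the variation of z,
    and each h_i has a positive mean ([path_action_bound]). All these estimates
    survive a small perturbation of H, uniformly in the base point
    ([period_form_coercive]).
    Therefore every l in [-1, 1] is a point of strong stability.

    Finally the set of points of strong stability is open ([strongly_stable_open]),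
    so the component of 0 is an open interval; it contains [-1, 1]
    ([central_zone_exists]). *)

Local Open Scope classical_set_scope.
Local Open Scope ring_scope.

(** * Primitives and comparison of derivatives *)

Section Calculus.
Variable R : realType.
Implicit Types (f g F G : R -> R) (a b t : R).

Lemma is_derive_continuous (V : normedModType R) (F f : R -> V) :
  (forall t, is_derive t 1 F (f t)) -> continuous F.
Proof.
move=> dF t; apply/differentiable_continuous/derivable1_diffP.
by have [] := dF t.
Qed.

Lemma derive_add (V : normedModType R) (F G : R -> V) t dF dG :
  is_derive t 1 F dF -> is_derive t 1 G dG ->
  is_derive t 1 (fun x => F x + G x) (dF + dG).
Proof. by move=> ? ?; exact: is_deriveD. Qed.

Lemma derive_sub (V : normedModType R) (F G : R -> V) t dF dG :
  is_derive t 1 F dF -> is_derive t 1 G dG ->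
  is_derive t 1 (fun x => F x - G x) (dF - dG).
Proof. by move=> ? ?; exact: is_deriveB. Qed.

Lemma derive_const (V : normedModType R) (c : V) t :
  is_derive t 1 (fun _ : R => c) 0.
Proof. exact: is_derive_cst. Qed.

Lemma derive_mul F G t dF dG :
  is_derive t 1 F dF -> is_derive t 1 G dG ->
  is_derive t 1 (fun x => F x * G x) (dF * G t + F t * dG).
Proof.
move=> dF' dG'; apply: is_derive_eq (is_deriveM dF' dG') _.
by rewrite /GRing.scale/= addrC [G t * _]mulrC.
Qed.

Lemma derive_cmul c F t dF : is_derive t 1 F dF ->
  is_derive t 1 (fun x => c * F x) (c * dF).
Proof. by move=> ?; exact: is_deriveZ. Qed.

Lemma derive_bigsum n (F : 'I_n -> R -> R) (dF : 'I_n -> R) t :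
  (forall i, is_derive t 1 (F i) (dF i)) ->
  is_derive t 1 (fun x => \sum_i F i x) (\sum_i dF i).
Proof.
move=> dF_; have -> : (fun x => \sum_i F i x) = \sum_i F i.
  by apply/funext => x; rewrite fct_sumE.
exact: is_derive_sum.
Qed.

Lemma derive_translate (V : normedModType R) (F : R -> V) (dF : V) c t :
  is_derive (t + c) 1 F dF -> is_derive t 1 (fun x => F (x + c)) dF.
Proof.
have E : (fun h => h^-1 *: ((F \o shift (t + c)) (h *: 1%R) - F (t + c))) =
  (fun h => h^-1 *: (((fun x => F (x + c)) \o shift t) (h *: 1%R) - F (t + c))).
  by apply/funext => h /=; rewrite addrA.
by move=> [dFt <-]; apply: DeriveDef; rewrite /derivable /derive -E.
Qed.

(** Integrating from minus infinity produces one primitive on the whole line,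
    where integrating from a finite base point would only serve one side of it. *)
Lemma primitive_supported f : continuous f -> (forall t, t <= -1 -> f t = 0) ->
  exists F, forall t, is_derive t 1 F (f t).
Proof.
move=> cf f0.
pose mu := @lebesgue_measure R.
exists (fun x => (\int[mu]_(t in [set` `]-oo, x]]) f t)%R) => t.
have int_cc : mu.-integrable `[(- 1)%R, (t + 1)%R] (EFin \o f).
  apply: continuous_compact_integrable; first exact: segment_compact.
  exact: continuous_subspaceT.
have int_f : mu.-integrable [set` `]-oo, (t + 1)%R]] (EFin \o f).
  apply: (integrable_mkcond _ _).2 => //.
  have -> : (EFin \o f) \_ [set` `]-oo, (t + 1)%R]] =
            (EFin \o f) \_ [set` `[- 1%R, (t + 1)%R]].
    apply/funext => x; rewrite !patchE !mem_setE !in_itv/=.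
    case: (leP (- 1) x) => //= x1.
    by case: ifP => // _; rewrite f0// ltW.
  by apply: (integrable_mkcond _ _).1.
have tt : t < t + 1 by rewrite ltrDl.
have [dF F'] := continuous_FTC1 tt int_f (ltNyr _) (cf t).
by apply: DeriveDef => //; rewrite -derive1E.
Qed.

(** A continuous cut-off [chi] splits [f] into a part that vanishes far to the
    left and a part that vanishes far to the right; the second one is reflected,
    so that both are integrated from minus infinity. *)
Lemma primitive_exists f a : continuous f ->
  exists2 F, F a = 0 & forall t, is_derive t 1 F (f t).
Proof.
move=> cf.
pose chi : R -> R := cst 0 \max (cst 1 \min (fun t => t + 1)).
have cchi : continuous chi.
  move=> t; apply/continuous_max/continuous_min; try exact: cst_continuous.
  by apply: continuousD; [exact: cvg_id|exact: cst_continuous].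
pose f1 t := f t * chi t.
pose f2 t := f (- t) * (1 - chi (- t)).
have cf2 : continuous f2.
  move=> t; apply: cvgM; last apply: cvgB; first 1 last.
  - exact: cvg_cst.
  - by apply: continuous_comp; [exact: opp_continuous|exact: cchi].
  - by apply: continuous_comp; [exact: opp_continuous|exact: cf].
have [||F1 dF1] := @primitive_supported f1.
- by move=> t; apply: cvgM; [exact: cf|exact: cchi].
- move=> t t1; rewrite /f1 /chi /=.
  have /min_idPr -> : t + 1 <= 1 by lra.
  by have /max_idPl -> : t + 1 <= 0; [lra|rewrite mulr0].
have [|F2 dF2] := @primitive_supported f2 cf2.
  move=> t t1; rewrite /f2 /chi /=.
  have /min_idPl -> : 1 <= - t + 1 by lra.
  by have /max_idPr -> : 0 <= 1 :> R by []; rewrite subrr mulr0.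
exists (fun t => F1 t - F2 (- t) - (F1 a - F2 (- a))).
  by rewrite subrr.
move=> t.
have dF2N : is_derive t 1 (fun t => F2 (- t)) (- f2 (- t)).
  have := @is_derive1_comp _ F2 -%R t _ _ (dF2 (- t)) (is_deriveNid t 1).
  by rewrite mulrN1.
have H1 := derive_sub (dF1 t) dF2N.
have H2 := derive_const (F1 a - F2 (- a)) t.
have H3 := derive_sub H1 H2.
apply: (is_derive_eq H3).
rewrite opprK subr0 /f1 /f2 opprK; ring.
Qed.


(** Together with the existence of primitives, this comparison replaces every
    integral inequality of the argument. *)
Lemma derive_le F G f g a b : a <= b ->
  (forall t, is_derive t 1 F (f t)) -> (forall t, is_derive t 1 G (g t)) ->
  (forall t, a <= t <= b -> f t <= g t) -> F b - F a <= G b - G a.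
Proof.
move=> ab dF dG fg.
have dGF t : is_derive t 1 (fun x => G x - F x) (g t - f t).
  exact: derive_sub.
have [c cab /= H] := @MVT_segment R _ _ a b ab (fun t _ => dGF t)
  (continuous_subspaceT (is_derive_continuous dGF)).
have : 0 <= (g c - f c) * (b - a).
  by rewrite mulr_ge0 ?subr_ge0// fg// -in_itv.
by rewrite -H; lra.
Qed.

Lemma derive_abs_le F G f g a b : a <= b ->
  (forall t, is_derive t 1 F (f t)) -> (forall t, is_derive t 1 G (g t)) ->
  (forall t, a <= t <= b -> `|f t| <= g t) -> `|F b - F a| <= G b - G a.
Proof.
move=> ab dF dG fg; have zero c t := derive_const c t.
rewrite ler_norml (derive_le ab dF dG) ?andbT; last first.
  by move=> t /fg; apply: le_trans; exact: ler_norm.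
have := @derive_le (fun t => 0 - G t) F _ f a b ab
  (fun t => derive_sub (zero _ 0 t) (dG t)) dF.
have H t : a <= t <= b -> 0 - g t <= f t.
  by move=> /fg; rewrite ler_norml sub0r => /andP[].
by move=> /(_ H); lra.
Qed.

Lemma derive_zero_const F s t : (forall t, is_derive t 1 F 0) -> F s = F t.
Proof.
move=> dF; wlog st : s t / s <= t.
  by move=> H; case: (leP s t) => [/H//|/ltW/H].
have := @derive_abs_le F (fun=> 0) _ _ s t st dF (fun t => derive_const 0 t).
rewrite subrr normr0 => /(_ (fun _ _ => lexx _)).
by rewrite normr_le0 subr_eq0 => /eqP.
Qed.

(** The Cauchy-Schwarz inequality for the weight [g], with primitives in place
    of integrals. *)
Lemma interval_cauchy_schwarz (g y p d : R -> R) L a b : a <= b -> 0 <= L ->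
  (forall t : R, 0 <= g t <= L) ->
  p a = 0 -> (forall t : R, is_derive t 1 p (g t * `|y t|)) ->
  d a = 0 -> (forall t : R, is_derive t 1 d (g t * y t ^+ 2)) ->
  p b ^+ 2 <= L * (b - a) * d b.
Proof.
move=> ab L0 g0L pa dp da dd.
(* The quadratic inequality in [mu] is what integration of
     0 <= g * (mu - |y|)^2 gives; its discriminant is the claim. *)
have key mu : 2 * mu * p b <= mu ^+ 2 * (L * (b - a)) + d b.
  have := @derive_le (fun t => 2 * mu * p t)
    (fun t => mu ^+ 2 * L * t + d t) _ _ a b ab
    (fun t => derive_cmul (2 * mu) (dp t))
    (fun t => derive_add (derive_cmul (mu ^+ 2 * L) (is_derive_id t 1)) (dd t)).
  have H t : a <= t <= b -> 2 * mu * (g t * `|y t|) <= mu ^+ 2 * L * 1 + g t * y t ^+ 2.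
    move=> _; have /andP[g0 gL] := g0L t.
    rewrite -(real_normK (num_real (y t))); set r := `|y t|.
    have H1 : 0 <= g t * (mu - r) ^+ 2 by rewrite mulr_ge0 ?sqr_ge0.
    have H2 : 0 <= (L - g t) * mu ^+ 2 by rewrite mulr_ge0 ?sqr_ge0 ?subr_ge0.
    lra.
  by move=> /(_ H); rewrite pa da; lra.
have d0 : 0 <= d b by have := key 0; lra.
(* When the leading coefficient vanishes the inequality is affine in [mu], so
   it forces [p b] to vanish. *)
have [LT0|LT] := eqVneq (L * (b - a)) 0.
  have [->|p0] := eqVneq (p b) 0; first by rewrite expr0n LT0 mul0r.
  have := key ((d b + 1) / p b); rewrite LT0 mulr0 add0r.
  have -> : 2 * ((d b + 1) / p b) * p b = 2 * (d b + 1) by field.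
  by lra.
move: key LT; set c := L * (b - a) => key c0.
have cp : 0 < c by rewrite lt_def c0 mulr_ge0 ?subr_ge0.
have := key (p b / c).
have -> : 2 * (p b / c) * p b = 2 * (p b ^+ 2 / c) by ring.
have -> : (p b / c) ^+ 2 * c = p b ^+ 2 / c by field.
move=> H; have : p b ^+ 2 / c <= d b by lra.
by rewrite ler_pdivrMr// mulrC.
Qed.

End Calculus.

(** * Vectors and vector-valued functions *)

Section Vectors.
Variables (R : realType) (k : nat).
Implicit Types (u v w : 'cV[R]_k) (A : 'M[R]_k).

Definition dot u v : R := \sum_i u i 0 * v i 0.

Lemma dotC u v : dot u v = dot v u.
Proof. by apply: eq_bigr => i _; rewrite mulrC. Qed.

Lemma dotDl u v w : dot (u + v) w = dot u w + dot v w.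
Proof. by rewrite -big_split; apply: eq_bigr => i _; rewrite !mxE mulrDl. Qed.

Lemma dotNl u w : dot (- u) w = - dot u w.
Proof. by rewrite -sumrN; apply: eq_bigr => i _; rewrite !mxE mulNr. Qed.

Lemma dotDr u v w : dot w (u + v) = dot w u + dot w v.
Proof. by rewrite dotC dotDl !(dotC w). Qed.

Lemma dot0l u : dot 0 u = 0.
Proof. by apply: big1 => i _; rewrite mxE mul0r. Qed.

Lemma dot_mulmxl A u v : dot (A *m u) v = dot u (A^T *m v).
Proof.
rewrite /dot; under eq_bigr do rewrite mxE mulr_suml.
rewrite exchange_big/=; apply: eq_bigr => j _.
rewrite mxE mulr_sumr; apply: eq_bigr => i _.
by rewrite mxE mulrCA mulrA.
Qed.

Lemma norm_entry m n (M : 'M[R]_(m, n)) i j : `|M i j| <= `|M|.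
Proof.
rewrite {2}/Num.Def.normr/= mx_normrE.
exact: (le_bigmax _ (fun ij : 'I_m * 'I_n => `|M ij.1 ij.2|) (i, j)).
Qed.

Lemma norm_le m n (M : 'M[R]_(m, n)) c : 0 <= c ->
  (forall i j, `|M i j| <= c) -> `|M| <= c.
Proof.
by move=> c0 H; rewrite /Num.Def.normr/= mx_normrE; apply: bigmax_le => // -[].
Qed.

(** Positivity of the norm excludes the empty vector, whose norm is no entry. *)
Lemma norm_attained v : 0 < `|v| -> exists i, `|v| = `|v i 0|.
Proof.
move=> v0; have [|[i j] H] := @mx_norm_neq0 _ _ _ v; first exact: lt0r_neq0.
by exists i; rewrite [LHS]H/= (ord1 j).
Qed.

Lemma norm_mulmx_le A v : `|A *m v| <= k%:R * `|A| * `|v|.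
Proof.
apply: norm_le => [|i j]; first by rewrite !mulr_ge0.
rewrite mxE (le_trans (ler_norm_sum _ _ _))//.
apply: (le_trans (ler_sum _ (_ : forall l, _ -> _ <= `|A| * `|v|))) => [l _|].
  by rewrite normrM ler_pM ?norm_entry.
by rewrite sumr_const card_ord -mulrA mulr_natl.
Qed.

Lemma dot_le u v : `|dot u v| <= k%:R * `|u| * `|v|.
Proof.
rewrite (le_trans (ler_norm_sum _ _ _))//.
apply: (le_trans (ler_sum _ (_ : forall l, _ -> _ <= `|u| * `|v|))) => [l _|].
  by rewrite normrM ler_pM ?norm_entry.
by rewrite sumr_const card_ord -mulrA mulr_natl.
Qed.

End Vectors.

Section VectorCalculus.
Variables (R : realType) (k : nat).
Implicit Types (u v : R -> 'cV[R]_k).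

Lemma is_derive_mxP m n (M : R -> 'M[R]_(m, n)) (t : R) dM :
  is_derive t 1 M dM <->
  forall i j, is_derive t 1 (fun x => M x i j) (dM i j).
Proof.
split=> [[Mt <-] i j|H].
  apply: DeriveDef; first exact: (derivable_mxP _ _ _).1.
  by rewrite derive_mx// mxE.
have Mt : derivable M t 1 by apply/derivable_mxP => i j; case: (H i j).
apply: DeriveDef => //; rewrite derive_mx//; apply/matrixP => i j.
by rewrite mxE; case: (H i j).
Qed.

Lemma derive_dot u v (t : R) du dv :
  is_derive t 1 u du -> is_derive t 1 v dv ->
  is_derive t 1 (fun x => dot (u x) (v x)) (dot du (v t) + dot (u t) dv).
Proof.
move=> /is_derive_mxP du_ /is_derive_mxP dv_; rewrite -big_split.
by apply: derive_bigsum => i; exact: derive_mul.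
Qed.

Lemma derive_mulmx m n (A : 'M[R]_(m, n)) (M : R -> 'cV[R]_n) (t : R) dM :
  is_derive t 1 M dM -> is_derive t 1 (fun x => A *m M x) (A *m dM).
Proof.
move=> /is_derive_mxP dM_; apply/is_derive_mxP => i j.
rewrite mxE.
have -> : (fun x => (A *m M x) i j) = (fun x => \sum_l A i l * M x l j).
  by apply/funext => x; rewrite mxE.
by apply: derive_bigsum => l; exact: derive_cmul.
Qed.

Lemma continuous_entry m n (M : R -> 'M[R]_(m, n)) i j :
  continuous M -> continuous (fun t => M t i j).
Proof.
move=> cM t; apply: (@continuous_comp _ _ _ M (fun N => N i j) t (cM t)).
exact: coord_continuous.
Qed.

Lemma vector_primitive (f : R -> 'cV[R]_k) a :
  (forall i, continuous (fun t => f t i 0)) ->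
  exists2 F : R -> 'cV[R]_k, F a = 0 & forall t : R, is_derive t 1 F (f t).
Proof.
move=> cf.
have /choice[F HF] : forall i, exists F : R -> R,
    F a = 0 /\ forall t : R, is_derive t 1 F (f t i 0).
  by move=> i; have [F F0 dF] := primitive_exists a (cf i); exists F.
exists (fun t => \col_i F i t).
  by apply/matrixP => i j; rewrite !mxE; case: (HF i).
move=> t; apply/is_derive_mxP => i j; rewrite (ord1 j).
have -> : (fun x => (\col_i F i x) i 0) = F i by apply/funext => x; rewrite mxE.
case: (HF i) => _; exact.
Qed.

Lemma derive_norm_le (F f : R -> 'cV[R]_k) a b c : a <= b -> 0 <= c ->
  (forall t : R, is_derive t 1 F (f t)) ->
  (forall t, a <= t <= b -> `|f t| <= c) -> `|F b - F a| <= c * (b - a).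
Proof.
move=> ab c0 dF fc; apply: norm_le => [|i j].
  by rewrite mulr_ge0 ?subr_ge0.
rewrite !mxE mulrBr.
apply: (@derive_abs_le _ (fun t => F t i j) (fun t => c * t)
  (fun t => f t i j) (fun=> c)) => // t.
- by have /is_derive_mxP := dF t.
- by have := derive_cmul c (is_derive_id t 1); rewrite mulr1.
- by move=> /fc; apply: le_trans; exact: norm_entry.
Qed.

End VectorCalculus.

(** * The coercivity estimate on an interval *)

Section Path.
Variables (R : realType) (k : nat) (A : 'M[R]_k) (h : R -> 'rV[R]_k).
Variables (L th : R).
Hypothesis A_skew : A^T = - A.
Hypothesis h_cont : forall i, continuous (fun t => h t 0 i).
Hypothesis h_ge0 : forall t i, 0 <= h t 0 i.
Hypothesis h_leL : forall t i, h t 0 i <= L.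
Hypothesis th0 : 0 <= th.
Hypothesis A_bound : forall p : 'cV[R]_k, (forall i, 0 <= p i 0) ->
  dot p (abs_mx A *m p) <= th * dot p p.

Lemma diag_entry t (v : 'cV[R]_k) i : (diag_mx (h t) *m v) i 0 = h t 0 i * v i 0.
Proof. by rewrite mul_diag_mx mxE. Qed.

Lemma abs_mx_sym : (abs_mx A)^T = abs_mx A.
Proof.
apply/matrixP => i j; rewrite !mxE.
by have /matrixP/(_ i j) := A_skew; rewrite !mxE => ->; rewrite normrN.
Qed.

Variables (z s e : R -> 'cV[R]_k) (a b N del : R).
Hypothesis ab : a <= b.
Hypothesis N0 : 0 <= N.
Hypothesis L0 : 0 <= L.
Hypothesis z_cont : forall i, continuous (fun t => z t i 0).
Hypothesis sa : s a = 0.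
Hypothesis ds : forall t : R, is_derive t 1 s (diag_mx (h t) *m z t).
Hypothesis z_le : forall t, a <= t <= b -> `|z t| <= N.
Hypothesis e_le : forall t, a <= t <= b -> `|e t| <= del.
Hypothesis zE : forall t, a <= t <= b -> z t = z a + A *m (s t + e t).

Let K := k%:R * `|A|.

Lemma diag_norm_le t : a <= t <= b -> `|diag_mx (h t) *m z t| <= L * N.
Proof.
move=> tab; apply: norm_le => [|i j]; first exact: mulr_ge0.
rewrite (ord1 j) diag_entry normrM ger0_norm// ler_pM//.
by rewrite (le_trans _ (z_le tab))// norm_entry.
Qed.

(** The coercivity estimate over one interval, for a path that is a solution of
    the unperturbed equation up to the error [e]. The number [d] is the integral
    of <z, diag(h) z>. Since [z a = z - A (s + e)],
    2 <z a, s b> = 2 d - 2 (integral of <A s, s'>) - (error), and the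
    middle term is dominated through |s_i| <= p_i, where p_i is the integral of
    h_i |z_i|, by the integral of 2 <p', |A| p>, that is by <p b, |A| p b>;
    Cauchy-Schwarz bounds this by th L (b - a) d. Conversely [d] controls the
    oscillation of [s], hence that of [z], so that [z t0 i 0 ^+ 2] times the
    integral of h_i is at most a multiple of [d] up to the error. *)
Lemma path_action_bound : exists d : R, [/\ 0 <= d,
  (2 - th * L * (b - a)) * d - 2 * k%:R * K * del * L * N * (b - a)
    <= 2 * dot (z a) (s b) &
  forall (eta : R -> R) i t0, a <= t0 <= b ->
    (forall t : R, is_derive t 1 eta (h t 0 i)) ->
    (eta b - eta a) * z t0 i 0 ^+ 2 <=
      (2 + 4 * (K * L * (b - a)) ^+ 2) * d + 16 * L * (b - a) * (K * del) ^+ 2].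
Proof.
have [|p pa dp] := @vector_primitive R k
    (fun t => \col_i (h t 0 i * `|z t i 0|)) a.
  move=> i; have -> : (fun t => (\col_i (h t 0 i * `|z t i 0|)) i 0) =
      (fun t => h t 0 i * `|z t i 0|) by apply/funext => t; rewrite mxE.
  by move=> t; apply: cvgM; [exact: h_cont|apply: cvg_norm; exact: z_cont].
have [|d da dd] := @vector_primitive R k
    (fun t => \col_i (h t 0 i * z t i 0 ^+ 2)) a.
  move=> i; have -> : (fun t => (\col_i (h t 0 i * z t i 0 ^+ 2)) i 0) =
      (fun t => h t 0 i * z t i 0 ^+ 2) by apply/funext => t; rewrite mxE.
  move=> t; apply: cvgM; [exact: h_cont|].
  by under eq_fun do rewrite expr2; rewrite expr2; apply: cvgM; exact: z_cont.
have dpi i (t : R) : is_derive t 1 (fun x => p x i 0) (h t 0 i * `|z t i 0|).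
  by have /is_derive_mxP/(_ i 0) := dp t; rewrite mxE.
have ddi i (t : R) : is_derive t 1 (fun x => d x i 0) (h t 0 i * z t i 0 ^+ 2).
  by have /is_derive_mxP/(_ i 0) := dd t; rewrite mxE.
have dsi i (t : R) : is_derive t 1 (fun x => s x i 0) (h t 0 i * z t i 0).
  by have /is_derive_mxP/(_ i 0) := ds t; rewrite diag_entry.
have s_le_p t1 t2 i : t1 <= t2 -> `|s t2 i 0 - s t1 i 0| <= p t2 i 0 - p t1 i 0.
  move=> t12; apply: (derive_abs_le t12 (dsi i) (dpi i)) => t _.
  by rewrite normrM ger0_norm.
have d_ge0 i : 0 <= d b i 0.
  have := derive_le ab (fun t => derive_const 0 t) (ddi i).
  rewrite subrr da mxE subr0; apply => t _.
  by rewrite mulr_ge0 ?sqr_ge0.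
have cs i : p b i 0 ^+ 2 <= L * (b - a) * d b i 0.
  apply: (interval_cauchy_schwarz (g := fun t => h t 0 i)
    (y := fun t => z t i 0) (p := fun t => p t i 0) (d := fun t => d t i 0)) => //.
  - by move=> t; rewrite h_ge0 h_leL.
  - by rewrite pa mxE.
  - by rewrite da mxE.
set dT := \sum_i d b i 0.
have dT0 : 0 <= dT by exact: sumr_ge0.
have d_le i : d b i 0 <= dT.
  by rewrite /dT (bigD1 i)//= lerDl sumr_ge0.
exists dT; split => //.
- have dG t := derive_add (derive_sub
    (derive_cmul 2 (derive_dot (derive_const (z a) t) (ds t)))
    (derive_cmul 2 (derive_bigsum (ddi^~ t))))
    (derive_dot (dp t) (derive_mulmx (abs_mx A) (dp t))).
  have H := @derive_le R (fun t => - (2 * k%:R * K * del * L * N) * t) _ _ _ a b ab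
    (fun t => derive_cmul _ (is_derive_id t 1)) dG.
  have s_le t i : a <= t -> `|s t i 0| <= p t i 0.
    by move=> ta; have := s_le_p a t i ta; rewrite sa pa mxE !subr0.
  (* The monotone quantity is 2 <z a, s> - 2 d + <p, |A| p>. *)
  have rate t : a <= t <= b ->
      - (2 * k%:R * K * del * L * N) * 1 <=
      2 * (dot 0 (s t) + dot (z a) (diag_mx (h t) *m z t)) -
      2 * (\sum_i h t 0 i * z t i 0 ^+ 2) +
      (dot (\col_i (h t 0 i * `|z t i 0|)) (abs_mx A *m p t) +
       dot (p t) (abs_mx A *m \col_i (h t 0 i * `|z t i 0|))).
    move=> tab; have /andP[ta tb] := tab.
    set q := \col_i _; set v := diag_mx (h t) *m z t.
    have zv : dot (z t) v = \sum_i h t 0 i * z t i 0 ^+ 2.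
      by apply: eq_bigr => i _; rewrite diag_entry expr2 mulrCA mulrA.
    have -> : dot (z a) v = dot (z t) v - dot (A *m s t) v - dot (A *m e t) v.
      by rewrite [z t](zE tab) mulmxDr !dotDl; ring.
    have Ae : `|dot (A *m e t) v| <= k%:R * (K * del) * (L * N).
      apply: (le_trans (dot_le _ _)); apply: ler_pM => //; last exact: diag_norm_le.
      rewrite ler_wpM2l// (le_trans (norm_mulmx_le _ _))// ler_wpM2l ?mulr_ge0//.
      exact: e_le.
    have As : dot (A *m s t) v <= dot q (abs_mx A *m p t).
      apply: ler_sum => i _; rewrite [q i 0]mxE diag_entry mulrC.
      apply: (le_trans (ler_norm _)); rewrite normrM.
      apply: ler_pM => //; first by rewrite normrM ger0_norm.
      rewrite !mxE (le_trans (ler_norm_sum _ _ _))// ler_sum// => j _.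
      by rewrite normrM !mxE ler_wpM2l ?s_le.
    have -> : dot (p t) (abs_mx A *m q) = dot q (abs_mx A *m p t).
      by rewrite dotC dot_mulmxl abs_mx_sym.
    rewrite dot0l zv; move: Ae; rewrite ler_norml => /andP[_ Ae]; lra.
  have {H} := H rate; rewrite sa pa da.
  have -> : \sum_i (0 : 'cV[R]_k) i 0 = 0 by apply: big1 => i _; rewrite mxE.
  rewrite dot0l (dotC _ 0) dot0l -/dT => H.
  have p_ge0 i : 0 <= p b i 0 by apply: le_trans (s_le b i ab).
  have Ap := A_bound p_ge0.
  have pp : dot (p b) (p b) <= L * (b - a) * dT.
    by rewrite /dot mulr_sumr ler_sum// => i _; rewrite -expr2.
  have := ler_wpM2l th0 pp.
  lra.
move=> eta i t0 /andP[at0 t0b] deta.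
set P := Num.sqrt (L * (b - a) * dT).
have LT0 : 0 <= L * (b - a) by rewrite mulr_ge0 ?subr_ge0.
have P2 : P ^+ 2 = L * (b - a) * dT by rewrite sqr_sqrtr// mulr_ge0.
have p_le_P j : p b j 0 <= P.
  rewrite -[p b j 0]ger0_norm -?sqrtr_sqr.
    by rewrite ler_wsqrtr// (le_trans (cs j))// ler_wpM2l.
  by have := s_le_p a b j ab; rewrite pa mxE subr0; exact: le_trans.
have s_osc t : a <= t <= b -> `|s t - s t0| <= P.
  move=> /andP[ta tb]; apply: norm_le => [|j j']; first exact: sqrtr_ge0.
  rewrite (ord1 j') !mxE (le_trans _ (p_le_P j))//.
  have pm t1 t2 : t1 <= t2 -> p t1 j 0 <= p t2 j 0.
    by move=> /(s_le_p _ _ j) H; rewrite -subr_ge0; apply: le_trans H.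
  have pa0 : p a j 0 = 0 by rewrite pa mxE.
  have [tt|/ltW tt] := leP t0 t.
    have := s_le_p _ _ j tt; have := pm _ _ at0; have := pm _ _ tb; lra.
  rewrite distrC.
  have := s_le_p _ _ j tt; have := pm _ _ ta; have := pm _ _ t0b; lra.
have z_osc t : a <= t <= b -> `|z t i 0 - z t0 i 0| <= K * (P + 2 * del).
  move=> tab; have t0ab : a <= t0 <= b by rewrite at0.
  have -> : z t i 0 - z t0 i 0 = (A *m ((s t - s t0) + (e t - e t0))) i 0.
    have -> : z t i 0 - z t0 i 0 = (z t - z t0) i 0 by rewrite !mxE.
    rewrite (zE tab) (zE t0ab) opprD addrACA subrr add0r -mulmxBr.
    by rewrite opprD addrACA.
  rewrite (le_trans (norm_entry _ _ _))// (le_trans (norm_mulmx_le _ _))//.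
  rewrite ler_wpM2l ?mulr_ge0// (le_trans (ler_normD _ _))// lerD ?s_osc//.
  rewrite (le_trans (ler_normB _ _))//; have := e_le tab; have := e_le t0ab; lra.
have K0 : 0 <= K by rewrite mulr_ge0.
set v := z t0 i 0.
have := derive_le ab (fun t => derive_cmul (v ^+ 2) (deta t))
  (fun t => derive_add (derive_cmul 2 (ddi i t))
     (derive_cmul (2 * L * (K * (P + 2 * del)) ^+ 2) (is_derive_id t 1))).
have rate t : a <= t <= b -> v ^+ 2 * h t 0 i <=
    2 * (h t 0 i * z t i 0 ^+ 2) + 2 * L * (K * (P + 2 * del)) ^+ 2 * 1.
  move=> /z_osc; rewrite -/v; set r := K * _ => zr.
  have r2 : (z t i 0 - v) ^+ 2 <= r ^+ 2.
    by rewrite -(real_normK (num_real (z t i 0 - v))) lerXn2r ?nnegrE// (le_trans _ zr).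
  (* v^2 <= 2 x^2 + 2 (x - v)^2, the difference being (2 x - v)^2 *)
  have H1 : 0 <= h t 0 i * (2 * z t i 0 - v) ^+ 2 by rewrite mulr_ge0 ?sqr_ge0.
  have H2 : h t 0 i * (z t i 0 - v) ^+ 2 <= L * r ^+ 2.
    by rewrite ler_pM ?sqr_ge0.
  lra.
move=> /(_ rate); rewrite da mxE => H.
have R2 : (K * (P + 2 * del)) ^+ 2 <= 2 * K ^+ 2 * (P ^+ 2) + 8 * (K * del) ^+ 2.
  have := sqr_ge0 (K * (P - 2 * del)); lra.
have := ler_wpM2l LT0 R2; have := d_le i; rewrite P2.
lra.
Qed.
End Path.

(** * The conserved quadratic form of a periodic system *)

Section Stability.
Variables (R : realType) (k : nat) (A : 'M[R]_k).
Hypothesis A_skew : A^T = - A.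

Lemma solution_increment (H1 : R -> 'M[R]_k) (z s : R -> 'cV[R]_k) t1 t2 :
  solves (fun t y => A *m H1 t *m y) z ->
  (forall t : R, is_derive t 1 s (H1 t *m z t)) ->
  z t2 - z t1 = A *m (s t2 - s t1).
Proof.
move=> dz ds.
suff : forall i, (z t2 - A *m s t2) i 0 = (z t1 - A *m s t1) i 0.
  move=> E; apply/matrixP => i j; have := E i.
  by rewrite (ord1 j) mulmxBr !mxE; lra.
move=> i; apply: (@derive_zero_const R (fun t => (z t - A *m s t) i 0)) => t.
have := derive_sub (dz t) (derive_mulmx A (ds t)).
by rewrite mulmxA subrr => /is_derive_mxP/(_ i 0); rewrite mxE.
Qed.

(** The conserved form. With [w] the increment of [s] over a period, the
    derivative is <A H1 z, w> + <z, H1 (z(t + T) - z(t))> and z(t + T) - z(t) is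
    [A w]; skewness of [A] and symmetry of [H1] cancel the two terms. In terms of
    the monodromy matrix M, it is half the form S of the Cayley transform
    M - 1 = A S (M + 1), evaluated at (M + 1) z. *)
Lemma period_form_const (H1 : R -> 'M[R]_k) T (z s : R -> 'cV[R]_k) t1 t2 :
  periodic T H1 -> (forall t, (H1 t)^T = H1 t) ->
  solves (fun t y => A *m H1 t *m y) z ->
  (forall t : R, is_derive t 1 s (H1 t *m z t)) ->
  dot (z t1) (s (t1 + T) - s t1) = dot (z t2) (s (t2 + T) - s t2).
Proof.
move=> perH symH dz ds.
apply: (@derive_zero_const R (fun t => dot (z t) (s (t + T) - s t))) => t.
have dsT : is_derive t 1 (fun x => s (x + T)) (H1 t *m z (t + T)).
  by apply: derive_translate; rewrite -(perH t); exact: ds.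
apply: (is_derive_eq (derive_dot (dz t) (derive_sub dsT (ds t)))).
rewrite -mulmxBr (solution_increment _ _ dz ds) -mulmxA dot_mulmxl A_skew.
rewrite mulNmx dotC dotNl [dot (z t) _]dotC (dot_mulmxl (H1 t)) symH.
by rewrite addNr.
Qed.


Variables (h : R -> 'rV[R]_k) (eta : 'I_k -> R -> R) (L th T kap : R).
Hypothesis h_cont : forall i, continuous (fun t => h t 0 i).
Hypothesis h_ge0 : forall t i, 0 <= h t 0 i.
Hypothesis h_leL : forall t i, h t 0 i <= L.
Hypothesis th_ge0 : 0 <= th.
Hypothesis A_bound : forall p : 'cV[R]_k, (forall i, 0 <= p i 0) ->
  dot p (abs_mx A *m p) <= th * dot p p.
Hypothesis T_gt0 : 0 < T.
Hypothesis L_ge0 : 0 <= L.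
Hypothesis thLT : th * L * T < 2.
Hypothesis kap_gt0 : 0 < kap.
Hypothesis deta : forall i (t : R), is_derive t 1 (eta i) (h t 0 i).
Hypothesis eta_ge : forall i t, kap <= eta i (t + T) - eta i t.

(** The constants do not depend on the base point [a], on the solution, or on
    the perturbation [H1]: the form is an eps-perturbation of one that is positive
    definite, measured against the maximum of |z| over a period, so that no growth
    estimate for solutions enters. *)
Lemma period_form_coercive : exists eps c : R, [/\ 0 < eps, 0 < c &
  forall (H1 : R -> 'M[R]_k) (z s : R -> 'cV[R]_k) a,
    (forall t, `|H1 t - diag_mx (h t)| < eps) ->
    solves (fun t y => A *m H1 t *m y) z ->
    (forall t : R, is_derive t 1 s (H1 t *m z t)) ->
    c * `|z a| ^+ 2 <= dot (z a) (s (a + T) - s a)].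
Proof.
set K := k%:R * `|A|.
pose C := 2 + 4 * (K * L * T) ^+ 2.
pose c1 := 2 * k%:R * K * L * T + 2 * k%:R.
pose c2 := 16 * L * T * K ^+ 2.
pose bet := 2 - th * L * T.
have K0 : 0 <= K by rewrite mulr_ge0.
have C0 : 0 < C by have := sqr_ge0 (K * L * T); rewrite /C; lra.
have bet0 : 0 < bet by rewrite subr_gt0.
have c10 : 0 <= c1 by rewrite addr_ge0 ?mulr_ge0// ltW.
have c20 : 0 <= c2 by rewrite !mulr_ge0 ?sqr_ge0// ltW.
pose B := bet * c2 + C * c1.
have B0 : 0 <= B by rewrite addr_ge0 ?mulr_ge0// ltW.
(* [r] is the relative error allowed for [e]; it is at most 1, so that [r ^+ 2]
   can be estimated by [r]. *)
pose r := Num.min 1 (bet * kap / (2 * (B + 1))).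
have r0 : 0 < r.
  by rewrite lt_min ltr01 divr_gt0// mulr_gt0// ltr_wpDl.
have r1 : r <= 1 by rewrite ge_min lexx.
have rB : r * B <= bet * kap / 2.
  have B1 : 0 < 2 * (B + 1) by rewrite mulr_gt0// ltr_wpDl.
  have : r * (2 * (B + 1)) <= bet * kap.
    by rewrite -ler_pdivlMr// ge_min lexx orbT.
  by lra.
have r_ge0 := ltW r0; have T_ge0 := ltW T_gt0.
(* k.+1 rather than k keeps the quotient meaningful in dimension 0. *)
exists (r / (k.+1%:R * T)), (bet * kap / (4 * C)); split.
- by rewrite divr_gt0// mulr_gt0.
- by rewrite divr_gt0// mulr_gt0.
move=> H1 z s a H1h dz ds.
have ab : a <= a + T by rewrite lerDl ltW.
have cz := is_derive_continuous dz.
(* [N] is the maximum of |z| over the period; all errors are measured by it. *)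
have [t0] := @EVT_max R (fun t => `|z t|) a (a + T) ab
  (continuous_subspaceT (fun t => cvg_norm (cz t))).
rewrite in_itv/= => t0ab zmax; set N := `|z t0| in zmax.
have z_le t : a <= t <= a + T -> `|z t| <= N.
  by move=> tab; apply: zmax; rewrite in_itv.
have N0 : 0 <= N by exact: normr_ge0.
have czi i : continuous (fun t => z t i 0) by exact: continuous_entry.
have [|s0 s0a ds0] := @vector_primitive R k (fun t => diag_mx (h t) *m z t) a.
  move=> i; have -> : (fun t => (diag_mx (h t) *m z t) i 0) =
      (fun t => h t 0 i * z t i 0) by apply/funext => t; exact: diag_entry.
  by move=> t; apply: cvgM; [exact: h_cont|exact: czi].
(* [e] is what the perturbation H1 - diag(h) adds to the integral [s0]. *)
pose e t := s t - s a - s0 t.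
have de (t : R) : is_derive t 1 e ((H1 t - diag_mx (h t)) *m z t).
  apply: (is_derive_eq (derive_sub (derive_sub (ds t) (derive_const (s a) t)) (ds0 t))).
  by rewrite subr0 mulmxBl.
have ea : e a = 0 by rewrite /e s0a !subrr.
have e_le t : a <= t <= a + T -> `|e t| <= r * N.
  move=> /andP[ta tb].
  set eps := r / _ in H1h.
  have eps0 : 0 <= eps by rewrite divr_ge0 ?mulr_ge0.
  have epsN0 : 0 <= k%:R * eps * N.
    by apply: mulr_ge0 => //; apply: mulr_ge0.
  have := derive_norm_le ta epsN0 de; rewrite ea subr0 => H.
  apply: (le_trans (H _)) => [u /andP[ua ut]|].
    rewrite (le_trans (norm_mulmx_le _ _))// ler_pM//.
    + by rewrite ler_wpM2l// ltW.
    + by apply: z_le; rewrite ua (le_trans ut).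
  have kT : k%:R * eps * T <= r.
    rewrite /eps; have -> : k%:R * (r / (k.+1%:R * T)) * T = r * (k%:R / k.+1%:R).
      by field; rewrite (gt_eqF T_gt0) gt_eqF// ltr_wpDr// ler0n.
    by rewrite ler_piMr ?ltW// ltr_pdivrMr// mul1r ltr_nat.
  have : k%:R * eps * N * (t - a) <= k%:R * eps * N * T.
    by rewrite ler_wpM2l//; lra.
  by move=> /le_trans; apply; rewrite mulrAC ler_wpM2r.
have zE t : a <= t <= a + T -> z t = z a + A *m (s0 t + e t).
  by move=> _; rewrite /e [s0 t + _]addrC subrK -(solution_increment a t dz ds) addrC subrK.
have rN0 : 0 <= r * N by rewrite mulr_ge0.
have [d [d0 lower osc]] := path_action_bound A_skew h_cont h_ge0 h_leL th_ge0
  A_bound ab N0 L_ge0 czi s0a ds0 z_le e_le zE.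
have sE : s (a + T) - s a = s0 (a + T) + e (a + T) by rewrite /e [s0 _ + _]addrC subrK.
have za : `|z a| <= N by apply: z_le; rewrite lexx.
have [N00|N00] := eqVneq N 0.
  have -> : z a = 0 by apply/eqP; rewrite -normr_le0 -N00.
  by rewrite dot0l normr0 expr0n mulr0.
have [i Ni] : exists i, `|z t0| = `|z t0 i 0|.
  by apply: norm_attained; rewrite lt_def N00.
have zN : z t0 i 0 ^+ 2 = N ^+ 2.
  by rewrite /N Ni real_normK ?num_real.
have := osc (eta i) i t0 t0ab (deta i).
have := lower.
have aTa : a + T - a = T by rewrite addrC addKr.
rewrite -/K aTa zN sE dotDr.
have ez : `|dot (z a) (e (a + T))| <= k%:R * N * (r * N).
  rewrite (le_trans (dot_le _ _))// ler_pM ?mulr_ge0//.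
    by rewrite ler_wpM2l.
  by apply: e_le; rewrite lexx andbT.
set X := dot (z a) (s0 _); set Y := dot (z a) (e _) in ez *.
have Yge : - (k%:R * N * (r * N)) <= Y.
  by move: ez; rewrite ler_norml => /andP[].
move=> low {}osc.
have key1 : bet * d - r * c1 * N ^+ 2 <= 2 * (X + Y).
  by rewrite /bet /c1; lra.
have key2 : kap * N ^+ 2 <= C * d + r * c2 * N ^+ 2.
  have rr : r ^+ 2 <= r by rewrite expr2 ler_piMr.
  have : c2 * N ^+ 2 * r ^+ 2 <= c2 * N ^+ 2 * r.
    by rewrite ler_wpM2l ?mulr_ge0 ?sqr_ge0.
  have : kap * N ^+ 2 <= (eta i (a + T) - eta i a) * N ^+ 2.
    by rewrite ler_wpM2r ?sqr_ge0.
  by rewrite /c2 /C; lra.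
have key3 : bet * kap / 2 * N ^+ 2 <= 2 * C * (X + Y).
  have := ler_wpM2l (ltW C0) key1; have := ler_wpM2l (ltW bet0) key2.
  have := ler_wpM2r (sqr_ge0 N) rB; rewrite /B; lra.
have key4 : bet * kap / (4 * C) * N ^+ 2 <= X + Y.
  rewrite -(ler_pM2l (_ : 0 < 2 * C)) ?mulr_gt0//.
  have -> : 2 * C * (bet * kap / (4 * C) * N ^+ 2) = bet * kap / 2 * N ^+ 2.
    by field; rewrite gt_eqF.
  exact: key3.
apply: le_trans key4; apply: ler_wpM2l.
  by rewrite divr_ge0 ?mulr_ge0// ltW.
by rewrite lerXn2r ?nnegrE.
Qed.
End Stability.

(** * The spectral norm and means of periodic functions *)

Section SpectralNorm.
Variables (R : realType) (k : nat).
Implicit Types (M : 'M[R]_k) (p : 'cV[R]_k).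

Lemma dot_ge0 p : 0 <= dot p p.
Proof. by apply: sumr_ge0 => i _; rewrite -expr2 sqr_ge0. Qed.

Lemma norm2E p : norm2 p = Num.sqrt (dot p p).
Proof. by congr Num.sqrt; apply: eq_bigr => i _; rewrite expr2. Qed.

Lemma dot_eq0 p : dot p p = 0 -> p = 0.
Proof.
move=> /psumr_eq0P H; apply/matrixP => i j; rewrite (ord1 j) mxE.
have /eqP := H (fun i _ => sqr_ge0 (p i 0)) i isT.
by rewrite mulf_eq0 orbb => /eqP.
Qed.

(** The supremum that defines the spectral norm is taken over a bounded set. *)
Lemma norm2_mulmx_le_spectral M p : norm2 p <= 1 -> norm2 (M *m p) <= spectral_norm M.
Proof.
move=> p1; apply: ub_le_sup; last by exists p.
exists (Num.sqrt (k%:R * (k%:R * `|M|) * (k%:R * `|M|))) => _ [v /= v1 <-].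
have v_le : `|v| <= 1.
  apply: norm_le => // i j; rewrite (ord1 j) (le_trans _ v1)// norm2E -sqrtr_sqr.
  rewrite ler_wsqrtr// /dot (bigD1 i)//= -expr2 lerDl.
  by apply: sumr_ge0 => l _; rewrite -expr2 sqr_ge0.
have Mv : `|M *m v| <= k%:R * `|M|.
  by rewrite (le_trans (norm_mulmx_le _ _))// ler_piMr// mulr_ge0.
rewrite norm2E ler_wsqrtr// (le_trans (ler_norm _))// (le_trans (dot_le _ _))//.
by rewrite ler_pM ?mulr_ge0// ler_wpM2l.
Qed.

Lemma spectral_norm_ge0 M : 0 <= spectral_norm M.
Proof.
have := @norm2_mulmx_le_spectral M 0; rewrite mulmx0 norm2E dot0l sqrtr0.
by move=> /(_ ler01).
Qed.

(** From |M p| <= S |p| and 2 <S p, M p> <= |S p|^2 + |M p|^2. *)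
Lemma dot_mulmx_le_spectral M p : dot p (M *m p) <= spectral_norm M * dot p p.
Proof.
have [/dot_eq0 ->|p0] := eqVneq (dot p p) 0; first by rewrite !dot0l mulr0.
have S0 := spectral_norm_ge0 M; set S := spectral_norm M in S0 *.
have MpS : dot (M *m p) (M *m p) <= S ^+ 2 * dot p p.
  have dp : 0 < dot p p by rewrite lt_def p0 dot_ge0.
  pose c := (Num.sqrt (dot p p))^-1.
  have dotZ (v : 'cV[R]_k) : dot (c *: v) (c *: v) = c ^+ 2 * dot v v.
    by rewrite mulr_sumr; apply: eq_bigr => i _; rewrite !mxE; ring.
  have c2 : c ^+ 2 = (dot p p)^-1 by rewrite exprVn sqr_sqrtr// ltW.
  have : norm2 (M *m (c *: p)) <= S.
    by apply: norm2_mulmx_le_spectral; rewrite norm2E dotZ c2 mulVf// sqrtr1.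
  rewrite norm2E -scalemxAr dotZ c2 => H.
  have : Num.sqrt ((dot p p)^-1 * dot (M *m p) (M *m p)) ^+ 2 <= S ^+ 2.
    by rewrite lerXn2r ?nnegrE ?sqrtr_ge0.
  rewrite sqr_sqrtr; last by rewrite mulr_ge0 ?dot_ge0// invr_ge0 ltW.
  by rewrite mulrC ler_pdivrMr.
have [S00|Sn0] := eqVneq S 0.
  have : dot (M *m p) (M *m p) = 0.
    by apply/eqP; rewrite eq_le dot_ge0 andbT (le_trans MpS)// S00 expr0n mul0r.
  by move=> /dot_eq0 ->; rewrite dotC dot0l S00 mul0r.
have Sp : 0 < S by rewrite lt_def Sn0.
have : 2 * S * dot p (M *m p) <= S ^+ 2 * dot p p + dot (M *m p) (M *m p).
  rewrite /dot !mulr_sumr -big_split/=; apply: ler_sum => i _.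
  by have := sqr_ge0 (S * p i 0 - (M *m p) i 0); lra.
move=> H; rewrite -(ler_pM2l (_ : 0 < 2 * S)) ?mulr_gt0//.
lra.
Qed.

End SpectralNorm.

Section PeriodicMean.
Variable R : realType.

(** The increment over a period does not depend on the base point, by
    periodicity; based at a point where [f] is positive, it is at least the
    contribution of a neighbourhood of that point. *)
Lemma periodic_mean_gt0 (f F : R -> R) T : 0 < T -> continuous f ->
  (forall t, 0 <= f t) -> periodic T f -> (exists t, 0 < f t) ->
  (forall t : R, is_derive t 1 F (f t)) ->
  exists2 c, 0 < c & forall t, F (t + T) - F t = c.
Proof.
move=> T0 cf f0 perf [t0 ft0] dF.
have const t : F (t + T) - F t = F (t0 + T) - F t0.
  apply: (@derive_zero_const R (fun t => F (t + T) - F t)) => u.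
  have dFT : is_derive u 1 (fun x => F (x + T)) (f u).
    by apply: derive_translate; rewrite -(perf u); exact: dF.
  by apply: (is_derive_eq (derive_sub dFT (dF u))); rewrite subrr.
exists (F (t0 + T) - F t0) => //.
have f2 : 0 < f t0 / 2 by rewrite divr_gt0.
have /cvgrPdist_lt/(_ _ f2)/nbhs_ballP[del /= del0 near_t0] := cf t0.
pose r := Num.min (del / 2) T.
have r0 : 0 < r by rewrite lt_min T0 divr_gt0.
have rT : r <= T by rewrite ge_min lexx orbT.
have rdel : r < del.
  by apply: (@le_lt_trans _ _ (del / 2)); [rewrite ge_min lexx|lra].
have t0r : t0 <= t0 + r by rewrite lerDl ltW.
have := derive_le t0r (fun t => derive_cmul (f t0 / 2) (is_derive_id t 1)) dF.
have H t : t0 <= t <= t0 + r -> f t0 / 2 * 1 <= f t.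
  move=> /andP[t0t tr].
  have : ball t0 del t by rewrite /ball/= ltr_norml; apply/andP; split; lra.
  by move=> /near_t0; rewrite ltr_norml => /andP[_]; lra.
move=> /(_ H) H1.
have rT' : t0 + r <= t0 + T by rewrite lerD2l.
have := derive_le rT' (fun t => derive_const 0 t) dF.
have H2 t : t0 + r <= t <= t0 + T -> 0 <= f t by [].
move=> /(_ H2) H3.
have : 0 < f t0 / 2 * r by rewrite mulr_gt0.
lra.
Qed.

End PeriodicMean.

(** * Strong stability and its zones *)

Section StrongStability.
Variables (R : realType) (k : nat) (J : 'M[R]_k).
Variables (h : R -> 'rV[R]_k) (L T : R).
Hypothesis J_skew : J^T = - J.
Hypothesis h_cont : forall i, continuous (fun t => h t 0 i).
Hypothesis h_ge0 : forall t i, 0 <= h t 0 i.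
Hypothesis h_leL : forall t i, h t 0 i <= L.
Hypothesis h_per : periodic T h.
Hypothesis h_pos : forall i, exists t, 0 < h t 0 i.
Hypothesis T_gt0 : 0 < T.
Hypothesis L_ge0 : 0 <= L.
Hypothesis J_small : spectral_norm (abs_mx J) * L * T < 2.

Lemma diag_continuous : continuous (fun t => diag_mx (h t)).
Proof.
move=> t; apply/cvgrPdist_le => eps eps0.
have : \forall u \near t, forall i, `|h t 0 i - h u 0 i| <= eps.
  apply: (@filter_forall R 'I_k (fun i u => `|h t 0 i - h u 0 i| <= eps) (nbhs t)) => i.
  by have /cvgrPdist_le := @h_cont i t; apply.
apply: filterS => u hu; apply: norm_le => [|i j]; first exact: ltW.
by rewrite !mxE; case: eqVneq => _; rewrite ?mulr1n// !mulr0n subrr normr0 ltW.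
Qed.

Lemma diag_periodic : periodic T (fun t => diag_mx (h t)).
Proof. by move=> t; rewrite h_per. Qed.

Lemma diag_norm_leL t : `|diag_mx (h t)| <= L.
Proof.
apply: norm_le => // i j; rewrite mxE; case: eqVneq => [->|_].
  by rewrite mulr1n ger0_norm.
by rewrite mulr0n normr0.
Qed.

Lemma mean_lower_bound : exists (eta : 'I_k -> R -> R) (kap : R),
  [/\ 0 < kap, forall i (t : R), is_derive t 1 (eta i) (h t 0 i) &
      forall i t, kap <= eta i (t + T) - eta i t].
Proof.
have /choice[eta Heta] : forall i, exists F : R -> R,
    (forall t : R, is_derive t 1 F (h t 0 i)) /\
    exists2 c, 0 < c & forall t, F (t + T) - F t = c.
  move=> i; have [F _ dF] := primitive_exists 0 (@h_cont i).
  exists F; split => //.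
  by apply: (periodic_mean_gt0 T_gt0 (@h_cont i)) => // t; rewrite h_per.
have /choice[c Hc] : forall i, exists c, 0 < c /\
    forall t, eta i (t + T) - eta i t = c.
  by move=> i; have [_ [c]] := Heta i; exists c.
exists eta, (\big[Num.min/1]_i c i); split.
- by apply: lt_bigmin => // i _; case: (Hc i).
- by move=> i; case: (Heta i).
- by move=> i t; rewrite (Hc i).2 bigmin_le.
Qed.

(** The conserved form is constant and bounds |z|^2 from above. *)
Lemma scaled_system_stable l : `|l| <= 1 -> exists2 eps : R, 0 < eps &
  forall H1 : R -> 'M[R]_k,
    continuous H1 -> periodic T H1 -> (forall t, (H1 t)^T = H1 t) ->
    (forall t, `|H1 t - diag_mx (h t)| < eps) -> stable_point J H1 l.
Proof.
move=> l1; pose A := l *: J.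
have A_skew : A^T = - A by rewrite /A linearZ/= J_skew scalerN.
have th0 := spectral_norm_ge0 (abs_mx J).
have A_bound (p : 'cV[R]_k) : (forall i, 0 <= p i 0) ->
    dot p (abs_mx A *m p) <= spectral_norm (abs_mx J) * dot p p.
  move=> p0; apply: le_trans (dot_mulmx_le_spectral _ _).
  apply: ler_sum => i _; rewrite ler_wpM2l// !mxE ler_sum// => j _.
  by rewrite ler_wpM2r// !mxE normrM ler_piMl.
have [eta [kap [kap0 deta eta_ge]]] := mean_lower_bound.
have [eps [c [eps0 c0 coer]]] := period_form_coercive A_skew h_cont h_ge0 h_leL
  th0 A_bound T_gt0 L_ge0 J_small kap0 deta eta_ge.
exists eps => // H1 cH1 perH1 symH1 H1h z dz.
have dzA : solves (fun t y => A *m H1 t *m y) z.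
  by move=> t; have := dz t; rewrite /A -!scalemxAl.
have cz := is_derive_continuous dz.
have [|s _ ds] := @vector_primitive R k (fun t => H1 t *m z t) 0.
  move=> i; have -> : (fun t => (H1 t *m z t) i 0) =
      (fun t => \sum_j H1 t i j * z t j 0) by apply/funext => t; rewrite mxE.
  apply: continuous_big => [|j _ t]; first exact: add_continuous.
  by apply: cvgM; apply: continuous_entry.
(* Either |z| <= 1 or |z| <= |z|^2. *)
exists (1 + dot (z 0) (s (0 + T) - s 0) / c) => t.
have := coer H1 z s t H1h dzA ds.
rewrite (period_form_const A_skew t 0 perH1 symH1 dzA ds).
set q := dot _ _; rewrite mulrC -ler_pdivlMr// => zq.
have [z1|z1] := leP `|z t| 1; first by have := sqr_ge0 `|z t|; lra.
have : `|z t| * 1 <= `|z t| ^+ 2 by rewrite expr2 ler_wpM2l// ltW.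
lra.
Qed.

Lemma strongly_stable_unit_ball l : `|l| <= 1 ->
  strongly_stable_point T J (fun t => diag_mx (h t)) l.
Proof.
move=> l1; have [eps eps0 st] := scaled_system_stable l1; split; last by exists eps.
apply: st.
- exact: diag_continuous.
- exact: diag_periodic.
- by move=> t; rewrite tr_diag_mx.
- by move=> t; rewrite subrr normr0.
Qed.

End StrongStability.

Section Zones.
Variables (R : realType) (k : nat) (J : 'M[R]_k) (H : R -> 'M[R]_k) (T C : R).
Hypothesis H_cont : continuous H.
Hypothesis H_per : periodic T H.
Hypothesis H_sym : forall t, (H t)^T = H t.
Hypothesis H_le : forall t, `|H t| <= C.

(** Replacing [l] by [l'] in the equation amounts to replacing [H1] by
    [(l' / l) *: H1], a small perturbation when [l'] is close to [l] because [H] is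
    bounded. At [l = 0] this rescaling is unavailable, and there every
    perturbation is stable whatever happens nearby. *)
Lemma strongly_stable_open l : l != 0 -> strongly_stable_point T J H l ->
  exists2 del : R, 0 < del &
    forall l', `|l' - l| < del -> strongly_stable_point T J H l'.
Proof.
move=> l0 [_ [eps eps0 st]].
have C0 : 0 <= C by apply: le_trans (H_le 0).
pose rho := Num.min 1 (eps / (2 * (C + 1))).
have C1 : 0 < 2 * (C + 1) by rewrite mulr_gt0// ltr_wpDl.
have rho0 : 0 < rho by rewrite lt_min ltr01 divr_gt0.
have rho1 : rho <= 1 by rewrite ge_min lexx.
have rhoC : rho * (2 * (C + 1)) <= eps.
  by rewrite -ler_pdivlMr// ge_min lexx orbT.
exists (rho * `|l|); first by rewrite mulr_gt0// normr_gt0.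
move=> l' ll'.
suff st' : forall H1 : R -> 'M[R]_k,
    continuous H1 -> periodic T H1 -> (forall t, (H1 t)^T = H1 t) ->
    (forall t, `|H1 t - H t| < eps / 4) -> stable_point J H1 l'.
  split; last by exists (eps / 4); rewrite ?divr_gt0.
  by apply: st' => // t; rewrite subrr normr0 divr_gt0.
move=> H1 cH1 perH1 symH1 H1H z dz.
have mu1 : `|l' / l - 1| <= rho.
  have -> : l' / l - 1 = (l' - l) / l by field.
  by rewrite normrM normfV ler_pdivrMr ?normr_gt0// ltW.
apply: (st (fun t => (l' / l) *: H1 t)).
- by move=> t; apply: cvgZ; [exact: cvg_cst|exact: cH1].
- by move=> t; rewrite perH1.
- by move=> t; rewrite linearZ/= symH1.
- move=> t; have -> : (l' / l) *: H1 t - H t =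
      (l' / l) *: (H1 t - H t) + (l' / l - 1) *: H t.
    by rewrite scalerBr scalerBl scale1r addrA subrK.
  apply: (le_lt_trans (ler_normD _ _)); rewrite (normrZ _ (H1 t - H t)) (normrZ _ (H t)).
  have mu2 : `|l' / l| <= 2.
    have := ler_normD (l' / l - 1) 1; rewrite subrK normr1; lra.
  have P1 : `|l' / l| * `|H1 t - H t| <= 2 * `|H1 t - H t|.
    by rewrite ler_wpM2r.
  have P2 : `|l' / l - 1| * `|H t| <= rho * C by rewrite ler_pM.
  apply: (le_lt_trans (lerD P1 P2)); have := H1H t; lra.
- move=> t; have := dz t; congr is_derive.
  by rewrite -!scalemxAr -!scalemxAl scalerA mulrCA divff// mulr1.
Qed.

(** The zone is the component of 0. It is open: points other than 0 are interior
    by rescaling, and 0 is interior to the unit interval. *)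
Lemma central_zone_exists :
  (forall l, `|l| <= 1 -> strongly_stable_point T J H l) ->
  exists2 Z : set R, central_stability_zone T J H Z & Z 1.
Proof.
move=> unit_st; set S := [set l | strongly_stable_point T J H l].
have ball_in (l del y : R) : (forall l', `|l' - l| < del -> S l') ->
    `|y - l| < del -> connected_component S l y.
  move=> lS yl; exists [set l' | `|l' - l| < del] => //; split.
  - by rewrite /= subrr normr0 (le_lt_trans _ yl).
  - by move=> l' /lS.
  - apply/connected_intervalP => u v /=.
    rewrite !ltr_norml => /andP[u1 u2] /andP[v1 v2] w /andP[uw wv].
    by rewrite /= ltr_norml; apply/andP; split; lra.
have S0 : S 0 by apply: unit_st; rewrite normr0.
exists (connected_component S 0); last first.
  apply: (@connected_component_max _ S `[0, 1]%classic) => /=.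
  - by rewrite in_itv/= lexx ler01.
  - by move=> l /=; rewrite in_itv/= => /andP[l0 l1]; apply: unit_st; rewrite ger0_norm.
  - by apply/connected_intervalP; exact: interval_is_interval.
  - by rewrite /= in_itv/= lexx ler01.
split; last exact: connected_component_refl.
split; last by exists 0.
rewrite openE => l Zl; have Sl : S l := connected_component_sub Zl.
have [del del0 lS] : exists2 del : R, 0 < del & forall l', `|l' - l| < del -> S l'.
  have [->|l0] := eqVneq l 0; last exact: strongly_stable_open.
  by exists 1 => // l'; rewrite subr0 => /ltW; exact: unit_st.
apply/nbhs_ballP; exists del => // y; rewrite /ball/= distrC => yl.
apply: connected_component_trans Zl _.
exact: ball_in lS yl.
Qed.

End Zones.

(** * OS-net *)

Lemma osnet_J_skew (R : realType) (n m : nat) (W : 'M[R]_(2 * m, n)) (K : 'M[R]_n) :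
  (osnet_J W K)^T = - osnet_J W K.
Proof.
rewrite /osnet_J /WeT /WdT /OmegaK !trmx_mul linearB/= !trmxK -mulmxA.
by rewrite -mulmxN -mulNmx opprB.
Qed.

(* hH: no diagonal entry of H vanishes identically, i.e. the nonnegative H is of
   positive type (its integral over a period is positive definite).  It holds
   whenever sigma' > 0, but a strictly increasing C1 function may have zeros of
   its derivative, and then the conclusion can fail: n = 2, m = 1, W = 1, b = 0, K small,
   not symmetric,
   sigma(s) = s - sin s, phi = 0 give H = 0, and the perturbations
   eps * diag(1, -1) of H make J H1 hyperbolic. *)
Theorem corollary1p1 (R : realType) (n m : nat) (hn : (1 <= n)%N)
  (hm : (1 <= m)%N)
  (W : 'M[R]_(2 * m, n)) (K : 'M[R]_n) (b : 'cV[R]_(2 * m))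
  (sigma : R -> R)
  (sigma_diff : forall s : R, derivable sigma s 1)
  (sigma_C1 : continuous (derive1 sigma))
  (T : R) (hT : 0 < T)
  (x0 : 'cV[R]_n) (phi : R -> 'cV[R]_n)
  (phi0 : phi 0 = x0)
  (phi_sol : solves (fun _ => osnet_field W K b sigma) phi)
  (phi_per : periodic T phi)
  (sigma_incr : {homo sigma : s s' / s < s'})
  (sigma_bdd : exists M : R, forall s : R, `|derive1 sigma s| <= M)
  (hH : forall i : 'I_(2 * m), exists t : R, 0 < osnet_H W b sigma phi t i i)
  (hJ : spectral_norm (abs_mx (osnet_J W K))
          < 2 / (sup (range (derive1 sigma)) * T)) :
  osnet_stable W K b sigma phi T.
Proof.
pose h t : 'rV[R]_(2 * m) := (map_mx (derive1 sigma) (WeT W *m phi t + b))^T.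
pose L := sup (range (derive1 sigma)).
have hE t i : h t 0 i = derive1 sigma ((WeT W *m phi t + b) i 0).
  by rewrite !mxE.
have sigma'_ge0 s : 0 <= derive1 sigma s.
  apply: (@incr_derive1_ge0 R sigma setT); rewrite ?interiorT//.
  by move=> x y _ _; exact: sigma_incr.
have sigma'_le s : derive1 sigma s <= L.
  apply: ub_le_sup; last by exists s.
  by have [M HM] := sigma_bdd; exists M => _ [u _ <-]; rewrite (le_trans (ler_norm _)).
have h_cont i : continuous (fun t => h t 0 i).
  have -> : (fun t => h t 0 i) = derive1 sigma \o (fun t => (WeT W *m phi t + b) i 0).
    by apply/funext => t; rewrite hE.
  have darg (t : R) := derive_add (derive_mulmx (WeT W) (phi_sol t)) (derive_const b t).
  have carg := @continuous_entry R _ _ _ i 0 (is_derive_continuous darg).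
  by move=> t; exact: (continuous_comp (carg t) (sigma_C1 _)).
have h_ge0 t i : 0 <= h t 0 i by rewrite hE.
have h_leL t i : h t 0 i <= L by rewrite hE.
have h_per : periodic T h by move=> t; rewrite /h phi_per.
have h_pos i : exists t, 0 < h t 0 i.
  by have [t] := hH i; rewrite /osnet_H [X in 0 < X]mxE eqxx mulr1n; exists t.
have L_gt0 : 0 < L.
  have m0 : (0 < 2 * m)%N by rewrite muln_gt0.
  by have [t ht] := h_pos (Ordinal m0); exact: lt_le_trans ht (h_leL _ _).
have J_small : spectral_norm (abs_mx (osnet_J W K)) * L * T < 2.
  by rewrite -mulrA -ltr_pdivlMr ?mulr_gt0.
have unit_st := strongly_stable_unit_ball (osnet_J_skew W K) h_cont h_ge0 h_leL
  h_per h_pos hT (ltW L_gt0) J_small.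
apply: (central_zone_exists (C := L) _ _ _ _ unit_st).
- exact: diag_continuous.
- exact: diag_periodic.
- by move=> t; rewrite tr_diag_mx.
- by move=> t; apply: diag_norm_leL => //; exact: ltW.
Qed.
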